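(* Let $p>2$ be a prime and let $n$ be a positive integer satisfying one of the following conditions: (1) every prime $q$ dividing $n$ satisfies $\nu_p(\sigma(q^{\nu_q(n)})) \le \lfloor \log_p(q^{\nu_q(n)})\rfloor$; or (2) every prime $q$ dividing $n$ which satisfies $\nu_p(\sigma(q^{\nu_q(n)})) = \lceil \log_p(q^{\nu_q(n)})\rceil$ is less than $p$; or (3) there is a unique prime $q>p$ dividing $n$ such that $\nu_p(\sigma(q^{\nu_q(n)})) = \lceil \log_p(q^{\nu_q(n)})\rceil$. Then $$\nu_p(\sigma(n)) \le \lceil \log_p n\rceil.$$ Equality occurs if every prime factor $q$ of $n$ is a solution of the Ljunggren-Nagell equation $$\frac{q^{k+1}-1}{q-1} = p^s$$ for some $k, s \in \mathbb{N}$.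
   Context: For a prime $p$ and a positive integer $m$, $\nu_p(m)$ denotes the exponent of the highest power of $p$ dividing $m$. $\sigma(n)$ is the sum of the positive divisors of $n$. $\log_p$ is the logarithm to base $p$, and $\lfloor\cdot\rfloor$, $\lceil\cdot\rceil$ are the floor and ceiling functions.
   Formalization: In the equality clause the exponent k is required to be ν_q(n), the exact exponent of q in n; with k arbitrary the clause fails, e.g. p = 3, n = 4 (q = 2, k = s = 1), where ν_3(σ(4)) = 0 but ⌈log_3 4⌉ = 2. *)

(* Defs.v *)
From mathcomp Require Import all_boot all_order all_algebra.
From mathcomp Require Import reals exp.

Set Implicit Arguments.
Unset Strict Implicit.
Unset Printing Implicit Defensive.

Import Order.TTheory GRing.Theory Num.Theory.

Local Open Scope ring_scope.

Definition sigma (n : nat) : nat := (\sum_(d <- divisors n) d)%N.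

Definition logb (R : realType) (b x : R) : R := ln x / ln b.

(* Stated in rat so that neither division nor subtraction is truncated. *)
Definition ljunggren_nagell (p q k s : nat) : Prop :=
  (q%:R ^+ k.+1 - 1) / (q%:R - 1) = p%:R ^+ s :> rat.

(* Main.v *)
(** For a prime power [q^a] we have [sigma (q^a) < q / (q - 1) * q^a], so the
    [p]-part [w] of [sigma (q^a)] satisfies [w < p * q^a], and [w > q^a] forces
    [logn p (sigma (q^a))] to be the ceiling of [log_p (q^a)].  Each of the three
    conditions therefore confines the primes [q | n] with [w > q^a] to those
    below [p], plus at most one prime [q0 > p].  Multiplying over all
    [q^a || n], the [p]-part of [sigma n] is at most [n] times the product of
    [q / (q - 1)] over these exceptional primes, and that product is less than
    [p].  When every [sigma (q^a)] is a power of [p], so is [sigma n], and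
    [n <= sigma n] gives the reverse inequality. *)

Require Import Defs.
From mathcomp Require Import all_boot all_order all_algebra.
From mathcomp Require Import reals exp.

Set Implicit Arguments.
Unset Strict Implicit.
Unset Printing Implicit Defensive.

Import Order.TTheory GRing.Theory Num.Theory.

Local Open Scope ring_scope.

(** * Multiplicativity of [sigma] and its values at prime powers *)

Lemma sigma_gt0 n : (0 < n)%N -> (0 < sigma n)%N.
Proof.
move=> n_gt0; rewrite /sigma (big_rem n) ?divisors_id //=.
by rewrite addn_gt0 n_gt0.
Qed.

Lemma leq_sigma n : (0 < n)%N -> (n <= sigma n)%N.
Proof.
by move=> n_gt0; rewrite /sigma (big_rem n) ?divisors_id //= leq_addr.
Qed.

(** Multiplication matches pairs of divisors of [m] and [n] with divisors of the product. It is
    injective because, by Gauss's lemma, the coprime factors of equal products divide each other. *)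
Lemma sigmaM m n : (0 < m)%N -> (0 < n)%N -> coprime m n ->
  sigma (m * n) = (sigma m * sigma n)%N.
Proof.
move=> m_gt0 n_gt0 co_mn; rewrite /sigma.
have co_div a b : (a %| m)%N -> (b %| n)%N -> coprime a b.
  by move=> am bn; apply: coprime_dvdl am _; apply: coprime_dvdr bn _.
have dvd_factor a b c d : coprime a d -> (a * b = c * d)%N -> (a %| c)%N.
  by move=> co_ad eq_ab; rewrite -(Gauss_dvdl c co_ad) -eq_ab dvdn_mulr.
transitivity (\sum_(d <- [seq (a * b)%N | a <- divisors m, b <- divisors n]) d)%N.
  apply/perm_big/uniq_perm; first exact: divisors_uniq.
    apply: allpairs_uniq; try exact: divisors_uniq.
    move=> x y /allpairsP[[a b] [/= + + ->]] /allpairsP[[c d] [/= + + ->]] /=.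
    rewrite -!dvdn_divisors // => am bn cm dn eq_ab.
    have eq_ba : (b * a = d * c)%N by rewrite mulnC eq_ab mulnC.
    have co_nm e f : (e %| m)%N -> (f %| n)%N -> coprime f e.
      by move=> em fn; rewrite coprime_sym co_div.
    congr pair; apply/eqP; rewrite eqn_dvd.
      rewrite (dvd_factor a b c d) ?co_div //=.
      by rewrite (dvd_factor c d a b) ?co_div.
    rewrite (dvd_factor b a d c) ?co_nm //=.
    by rewrite (dvd_factor d c b a) ?co_nm.
  move=> d; rewrite -dvdn_divisors ?muln_gt0 ?m_gt0 //.
  apply/idP/allpairsP => [d_mn | [[a b] [/= + + ->]]]; last first.
    by rewrite -!dvdn_divisors //; apply: dvdn_mul.
  (* The two gcds split [d] into its part inside [m] and its part inside [n]. *)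
  exists (gcdn d m, gcdn d n); rewrite /= -!dvdn_divisors // !dvdn_gcdr; split=> //.
  apply/eqP; rewrite eqn_dvd Gauss_dvd ?co_div ?dvdn_gcdr // !dvdn_gcdl !andbT.
  by rewrite muln_gcdr dvdn_gcd dvdn_mull // muln_gcdl dvdn_gcd d_mn dvdn_mulr.
rewrite big_allpairs_dep big_distrl; apply: eq_bigr => a _.
by rewrite big_distrr.
Qed.

Lemma sigma_pfactor q a : prime q -> sigma (q ^ a) = (\sum_(i < a.+1) q ^ i)%N.
Proof.
move=> q_pr; rewrite -(big_mkord predT (expn q)) -[RHS](big_map (expn q) predT id).
apply/perm_big/uniq_perm; first exact: divisors_uniq.
  by rewrite map_inj_uniq ?iota_uniq //; apply/expnI/prime_gt1.
move=> d; rewrite -dvdn_divisors ?expn_gt0 ?prime_gt0 //.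
apply/(dvdn_pfactor d a q_pr)/mapP => -[i i_le ->]; exists i => //.
  by rewrite mem_index_iota.
by rewrite mem_index_iota in i_le.
Qed.

(** The geometric series makes the left side [q ^ a.+1 - 1]; keeping [q.-1] as a factor avoids a
    division in [nat]. *)
Lemma sigma_pfactor_lt q a : prime q ->
  (q.-1 * sigma (q ^ a) < q * q ^ a)%N.
Proof.
move=> q_pr; rewrite sigma_pfactor // -predn_exp -expnS prednK //.
by rewrite expn_gt0 prime_gt0.
Qed.

Lemma sigma_primes n : (0 < n)%N ->
  sigma n = (\prod_(q <- primes n) sigma (q ^ logn q n))%N.
Proof.
move=> n_gt0; rewrite {1}(prod_prime_decomp n_gt0) prime_decompE big_map /=.
have := all_prime_primes n; have := primes_uniq n.
elim: (primes n) => [|q s IHs] /=; first by rewrite !big_nil /sigma big_seq1.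
move=> /andP[q_notin uniq_s] /andP[q_pr pr_s]; rewrite !big_cons.
have gt0 r : prime r -> (0 < r ^ logn r n)%N.
  by move=> r_pr; rewrite expn_gt0 prime_gt0.
rewrite sigmaM ?IHs ?gt0 //.
  by rewrite big_seq; apply: prodn_cond_gt0 => r /(allP pr_s)/gt0.
rewrite big_seq; apply: (big_ind (coprime _)) => [|x y co_x co_y|r r_s]; first exact: coprimen1.
  by rewrite coprimeMr co_x.
have r_pr := allP pr_s r r_s.
rewrite coprimeXl // coprimeXr // prime_coprime // dvdn_prime2 //.
by apply: contraNneq q_notin => ->.
Qed.

(** * Comparison of the [p]-part of [sigma n] with [n] *)

Lemma expn_logn_prod p (I : eqType) (s : seq I) (F : I -> nat) :
    (forall i, i \in s -> 0 < F i)%N ->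
  (p ^ logn p (\prod_(i <- s) F i) = \prod_(i <- s) p ^ logn p (F i))%N.
Proof.
move=> F_gt0; rewrite big_seq [RHS]big_seq.
(* Positivity is carried through the induction because [lognM] requires it of both factors. *)
pose K x y := (0 < x /\ p ^ logn p x = y)%N.
suff [] : K (\prod_(i <- s | i \in s) F i)%N
            (\prod_(i <- s | i \in s) p ^ logn p (F i))%N by [].
apply: big_ind2 => [|x1 y1 x2 y2 [x1_gt0 <-] [x2_gt0 <-]|i /F_gt0 //].
  by rewrite /K logn1.
by rewrite /K muln_gt0 x1_gt0 lognM // expnD.
Qed.

(** The [p]-part divides [sigma (q ^ a)], which is below [2 * q ^ a] since [q <= 2 * q.-1]. *)
Lemma expn_logn_sigma_pfactor_lt p q a : (2 < p)%N -> prime q ->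
  (p ^ logn p (sigma (q ^ a)) < p * q ^ a)%N.
Proof.
move=> p_gt2 q_pr; have q_gt1 := prime_gt1 q_pr.
have qa_gt0 : (0 < q ^ a)%N by rewrite expn_gt0 prime_gt0.
apply: leq_ltn_trans (dvdn_leq (sigma_gt0 qa_gt0) (pfactor_dvdnn p _)) _.
apply: leq_trans (_ : (2 * q ^ a <= _)%N); last by rewrite leq_mul2r (ltnW p_gt2) orbT.
rewrite -(ltn_pmul2l (m := q.-1)) -?subn1 ?subn_gt0 //.
apply: leq_trans (_ : (q * q ^ a <= _)%N); first by rewrite subn1 sigma_pfactor_lt.
rewrite mulnA leq_mul2r; apply/orP; right.
by case: q q_gt1 {q_pr qa_gt0} => [|[|q]] // _; rewrite subn1 /= muln2 -addnn addnS addSn !ltnS leq_addr.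
Qed.

(** Passing from [s] to [t] only inserts factors that are at least 1. This lets a product over
    unknown primes be enlarged to one that telescopes. *)
Lemma prodr_uniq_le (R : numDomainType) (I : eqType) (s t : seq I) (F : I -> R) :
    uniq s -> uniq t -> {subset s <= t} -> (forall i, i \in t -> 1 <= F i) ->
  \prod_(i <- s) F i <= \prod_(i <- t) F i.
Proof.
move=> uniq_s uniq_t sub_st F_ge1.
have eq_s : perm_eq s [seq i <- t | i \in s].
  apply: uniq_perm; rewrite ?filter_uniq // => i.
  by rewrite mem_filter; case: (boolP (i \in s)) => // /sub_st ->.
rewrite (perm_big _ eq_s) big_filter big_mkcond big_seq [leRHS]big_seq; apply: ler_prod => i i_t.
by case: ifP; rewrite ?lexx ?ler01 ?F_ge1 ?(le_trans ler01) ?F_ge1.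
Qed.

(* The product over 2 <= m < p telescopes to p - 1, and the extra factor
   q0 / (q0 - 1) <= (p + 1) / p still leaves (p - 1)(p + 1) / p < p. *)
Lemma prod_ratio_lt p q0 (s : seq nat) :
    (2 < p)%N -> (p < q0)%N -> uniq s ->
    (forall q, q \in s -> 1 < q /\ (q < p \/ q = q0))%N ->
  \prod_(q <- s) (q%:R / q.-1%:R) < p%:R :> rat.
Proof.
move=> p_gt2 p_lt uniq_s s_small.
have ratio_ge1 q : (1 < q)%N -> 1 <= q%:R / q.-1%:R :> rat.
  case: q => [|[|q]] // _; by rewrite ler_pdivlMr ?ltr0n // mul1r ler_nat leqnSn.
apply: le_lt_trans (_ : \prod_(q <- q0 :: index_iota 2 p) (q%:R / q.-1%:R) < _).
  apply: prodr_uniq_le => //=.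
  - by rewrite iota_uniq mem_index_iota (ltnNge q0) (ltnW p_lt) andbF.
  - move=> q /s_small[q_gt1 [q_lt|->]]; rewrite inE ?eqxx //.
    by rewrite mem_index_iota q_gt1 q_lt orbT.
  move=> q; rewrite inE mem_index_iota => /orP[/eqP->|/andP[q_gt1 _]].
    by rewrite ratio_ge1 // (ltn_trans _ p_lt) // ltnW.
  exact: ratio_ge1.
rewrite big_cons (telescope_prodf_eq (fun k => k.-1%:R)) //; last first.
  by case=> [|[|k]] // _; rewrite pnatr_eq0.
rewrite divr1 mulrAC ltr_pdivrMr ?ltr0n -?natrM ?ltr_nat.
  case: q0 p_lt p_gt2 {s_small} => // q0; case: p => // p; rewrite ltnS => p_lt _ /=.
  by rewrite mulSn mulnC mulSn ltn_add2r.
by case: q0 p_lt {s_small} => // q0; rewrite ltnS; apply: leq_trans; rewrite (ltn_trans _ p_gt2).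
Qed.

(** Nothing forces [q0] to divide [n], so the case without an exceptional prime above [p] is covered
    as well. *)
Lemma expn_logn_sigma_lt p n q0 :
    (2 < p)%N -> (0 < n)%N -> (p < q0)%N ->
    (forall q, prime q -> (q %| n)%N ->
       (q ^ logn q n < p ^ logn p (sigma (q ^ logn q n)))%N ->
       (q < p)%N \/ q = q0) ->
  (p ^ logn p (sigma n) < p * n)%N.
Proof.
move=> p_gt2 n_gt0 p_lt excess_small.
pose w q := (p ^ logn p (sigma (q ^ logn q n)))%N.
pose excess q := (q ^ logn q n < w q)%N.
have primesP q : q \in primes n -> prime q /\ (q %| n)%N.
  by rewrite mem_primes => /and3P[].
rewrite sigma_primes // expn_logn_prod => [|q /primesP[q_pr _]]; last first.
  by rewrite sigma_gt0 // expn_gt0 prime_gt0.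
rewrite -(ltr_nat rat) natrM natr_prod.
have n_eq : n%:R = \prod_(q <- primes n) (q ^ logn q n)%:R :> rat.
  by rewrite -natr_prod {1}(prod_prime_decomp n_gt0) prime_decompE big_map.
have n_pos : 0 < n%:R :> rat by rewrite ltr0n.
apply: le_lt_trans
  (_ : (\prod_(q <- [seq q <- primes n | excess q]) (q%:R / q.-1%:R)) * n%:R < _); last first.
  rewrite ltr_pM2r //; apply: (prod_ratio_lt p_gt2 p_lt).
    by rewrite filter_uniq ?primes_uniq.
  move=> q; rewrite mem_filter => /andP[q_exc /primesP[q_pr q_n]].
  by split; [exact: prime_gt1 | exact: excess_small].
(* The comparison is made prime by prime: an exceptional [q] costs the ratio [q / q.-1], any other
   costs 1. *)
rewrite n_eq big_filter [X in _ <= X * _]big_mkcond -big_split /= big_seq [leRHS]big_seq.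
apply: ler_prod => q /primesP[q_pr _]; rewrite ler0n /=.
case: ifP => [_|/negbT]; last by rewrite mul1r ler_nat /excess -leqNgt.
have q1_gt0 : (0 < q.-1)%N by rewrite -subn1 subn_gt0 prime_gt1.
rewrite mulrAC ler_pdivlMr ?ltr0n // -!natrM ler_nat mulnC.
apply: leq_trans (ltnW (sigma_pfactor_lt _ q_pr)); rewrite leq_mul2l.
by rewrite dvdn_leq ?orbT ?pfactor_dvdnn // sigma_gt0 // expn_gt0 prime_gt0.
Qed.

(** * Floors and ceilings of logarithms as inequalities between naturals *)

Section Logb.
Variables (R : realType) (p : nat).
Hypothesis p_gt1 : (1 < p)%N.

Let ln_p_gt0 : 0 < ln (p%:R : R).
Proof. by rewrite ln_gt0 // ltr1n. Qed.

Lemma ceil_logb_le (m v : nat) : (0 < m)%N ->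
  (Num.ceil (logb (p%:R : R) m%:R) <= v%:Z) = (m <= p ^ v)%N.
Proof.
move=> m_gt0; have p_gt0 := ltnW p_gt1.
rewrite ceil_le_int /logb ler_pdivrMr // -pmulrn mulr_natl -lnXn ?ltr0n //.
by rewrite -natrX ler_ln ?posrE ?ltr0n ?expn_gt0 ?p_gt0 // ler_nat.
Qed.

Lemma floor_logb_ge (m v : nat) : (0 < m)%N ->
  (v%:Z <= Num.floor (logb (p%:R : R) m%:R)) = (p ^ v <= m)%N.
Proof.
move=> m_gt0; have p_gt0 := ltnW p_gt1.
rewrite floor_ge_int /logb ler_pdivlMr // -pmulrn mulr_natl -lnXn ?ltr0n //.
by rewrite -natrX ler_ln ?posrE ?ltr0n ?expn_gt0 ?p_gt0 // ler_nat.
Qed.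

(** An integer is at most the ceiling of [x] exactly when its predecessor is below [x]. The factor
    [p] on the right stands for that predecessor, so [v = 0] causes no truncation; there both sides
    hold. *)
Lemma ceil_logb_ge (m v : nat) : (0 < m)%N ->
  (v%:Z <= Num.ceil (logb (p%:R : R) m%:R)) = (p ^ v < p * m)%N.
Proof.
move=> m_gt0; have p_gt0 := ltnW p_gt1.
case: v => [|v].
  rewrite expn0 ceil_ge0 (lt_le_trans (ltrN10 _)) ?divr_ge0 ?ln_ge0 ?ler1n //.
  by rewrite (leq_trans p_gt1) ?leq_pmulr.
rewrite expnS ltn_pmul2l // ltnNge -ceil_logb_le // -ltNge.
by rewrite [v.+1%:Z]intS addrC lezD1.
Qed.

End Logb.

(** * Ljunggren-Nagell solutions and the final assembly *)

Lemma ljunggren_nagell_sigma p q s k : prime q ->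
  ljunggren_nagell p q k s -> sigma (q ^ k) = (p ^ s)%N.
Proof.
move=> q_pr; rewrite /ljunggren_nagell subrX1 mulrAC divff ?mul1r; last first.
  by rewrite subr_eq0 pnatr_eq1 neq_ltn prime_gt1 ?orbT.
move=> sum_eq; apply/eqP; rewrite -(eqr_nat rat) natrX -sum_eq sigma_pfactor //.
by rewrite natr_sum; apply/eqP/eq_bigr => i _; rewrite natrX.
Qed.

Theorem theorem1p4 (R : realType) (p n : nat)
    (p_prime : prime p) (p_gt2 : (2 < p)%N) (n_gt0 : (0 < n)%N)
    (cond :
      (forall q : nat, prime q -> (q %| n)%N ->
         (logn p (sigma (q ^ logn q n)))%:Z
           <= Num.floor (logb (p%:R : R) (q ^ logn q n)%N%:R))
      \/
      (forall q : nat, prime q -> (q %| n)%N ->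
         (logn p (sigma (q ^ logn q n)))%:Z
           = Num.ceil (logb (p%:R : R) (q ^ logn q n)%N%:R) ->
         (q < p)%N)
      \/
      (exists! q : nat,
         [/\ prime q, (p < q)%N, (q %| n)%N &
          (logn p (sigma (q ^ logn q n)))%:Z
            = Num.ceil (logb (p%:R : R) (q ^ logn q n)%N%:R)])) :
  (logn p (sigma n))%:Z <= Num.ceil (logb (p%:R : R) n%:R)
  /\
  ((forall q : nat, prime q -> (q %| n)%N ->
      exists k s : nat, k = logn q n /\ ljunggren_nagell p q k s) ->
   (logn p (sigma n))%:Z = Num.ceil (logb (p%:R : R) n%:R)).
Proof.
have p_gt1 : (1 < p)%N by exact: ltnW.
have qpow_gt0 q : prime q -> (0 < q ^ logn q n)%N.
  by move=> q_pr; rewrite expn_gt0 prime_gt0.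
have ceil_eq q : prime q ->
    (q ^ logn q n < p ^ logn p (sigma (q ^ logn q n)))%N ->
    (logn p (sigma (q ^ logn q n)))%:Z
      = Num.ceil (logb (p%:R : R) (q ^ logn q n)%N%:R).
  (* The excess gives one inequality, the bound by [p * q ^ a] the other. *)
  move=> q_pr lt_qp; apply/eqP; rewrite eq_le ceil_logb_ge ?ceil_logb_le ?qpow_gt0 //.
  by rewrite expn_logn_sigma_pfactor_lt // ltnW.
have upper : (logn p (sigma n))%:Z <= Num.ceil (logb (p%:R : R) n%:R).
  rewrite ceil_logb_ge //.
  have [q0 p_lt excess] : exists2 q0, (p < q0)%N & forall q, prime q -> (q %| n)%N ->
      (q ^ logn q n < p ^ logn p (sigma (q ^ logn q n)))%N -> (q < p)%N \/ q = q0.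
    case: cond => [c1 | [c2 | [q0 [[q0_pr p_lt _ _] q0_uniq]]]].
    (* Conditions (1) and (2) single out no prime above [p], so [p.+1] is a placeholder; under (1)
       no prime is exceptional at all. *)
    - exists p.+1 => // q q_pr q_n; rewrite ltnNge -(floor_logb_ge R) ?qpow_gt0 //.
      by rewrite c1.
    - exists p.+1 => // q q_pr q_n /ceil_eq-/(_ q_pr) eq_q.
      by left; apply: c2.
    exists q0 => // q q_pr q_n lt_q; case: (ltngtP q p) => [|p_q|eq_qp]; first by left.
      by right; rewrite (q0_uniq q) //; split=> //; exact: ceil_eq.
    (* The prime [p] itself is never exceptional: [sigma (p ^ a)] is 1 modulo [p], so its [p]-part
       is 1. *)
    suff logn0 : logn p (sigma (q ^ logn q n)) = 0%N.
      by move: lt_q; rewrite logn0 expn0 ltnNge qpow_gt0.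
    rewrite eq_qp sigma_pfactor // big_ord_recl expn0 lognE p_prime /=.
    rewrite dvdn_addl ?dvdn1 ?(gtn_eqF p_gt1) ?andbF //.
    by apply: dvdn_sum => i _; rewrite expnS dvdn_mulr.
  exact: expn_logn_sigma_lt p_gt2 n_gt0 p_lt excess.
split=> // LN; apply/eqP; rewrite eq_le upper /= ceil_logb_le //.
(* If [sigma n] is its own [p]-part, the inequality still needed is just [n <= sigma n]. *)
suff -> : (p ^ logn p (sigma n) = sigma n)%N by exact: leq_sigma.
rewrite sigma_primes // expn_logn_prod => [|q].
  rewrite big_seq [RHS]big_seq; apply: eq_bigr => q; rewrite mem_primes => /and3P[q_pr _ q_n].
  have [k [s [-> /(ljunggren_nagell_sigma q_pr) ->]]] := LN q q_pr q_n.
  by rewrite pfactorK.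
by rewrite mem_primes => /and3P[q_pr _ _]; rewrite sigma_gt0 ?qpow_gt0.
Qed.
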